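(* Let $X\in\mathbb{R}^{m\times n}$ with $\operatorname{rank}(X)=r\le d$, let $M\ge 2$ be an integer, and let $0<p\le 1$ and $p_1,\dots,p_M>0$ satisfy $\sum_{i=1}^{M}1/p_i=1/p$. Consider factorizations $X=U_1U_2\cdots U_M$ with $U_1\in\mathbb{R}^{m\times d}$, $U_i\in\mathbb{R}^{d\times d}$ for $1<i<M$, and $U_M\in\mathbb{R}^{d\times n}$. Then, with minima over all such factorizations (and attained), \[ \|X\|_{S_p}=\min_{X=\prod_{i=1}^{M}U_i}\prod_{i=1}^{M}\|U_i\|_{S_{p_i}} =\min_{X=\prod_{i=1}^{M}U_i}\left(\frac{\sum_{i=1}^{M}\|U_i\|_{S_{p_i}}^{p_i}/p_i}{1/p}\right)^{1/p}. \]
   Context: For $0<q<\infty$ and a real matrix $Y$ with singular values $\sigma_1(Y),\dots,\sigma_k(Y)$ ($k$ the smaller dimension of $Y$), the Schatten-$q$ (quasi-)norm is $\|Y\|_{S_q}=\left(\sum_{i=1}^{k}\sigma_i(Y)^q\right)^{1/q}$. *)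

(* Defs.v *)
From HB Require Import structures.
From mathcomp Require Import all_boot all_order all_algebra.
From mathcomp Require Import all_classical all_reals.
From mathcomp Require Import exp.
Set Implicit Arguments. Unset Strict Implicit. Unset Printing Implicit Defensive.
Import Order.TTheory GRing.Theory Num.Theory.
Local Open Scope ring_scope.

Section Schatten.
Variable R : realType.

(* s is the list of singular values of A (m x n): k = minn m n nonnegative
   reals whose squares, together with n - k zeros, are the eigenvalues
   (with multiplicity) of A^T A, i.e. the roots of its characteristic polynomial. *)
Definition is_singular_values (m n : nat) (A : 'M[R]_(m, n)) (s : seq R) : Prop :=
  [/\ size s = minn m n, all (fun x => 0 <= x) s &
      char_poly (A^T *m A) = 'X^(n - minn m n) * \prod_(x <- s) ('X - (x ^+ 2)%:P)].

Definition singular_values (m n : nat) (A : 'M[R]_(m, n)) : seq R :=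
  xget [::] (is_singular_values A).

Definition schatten (q : R) (m n : nat) (A : 'M[R]_(m, n)) : R :=
  (\sum_(x <- singular_values A) x `^ q) `^ q^-1.

Definition mprod (d : nat) (mid : nat -> 'M[R]_d) (k : nat) : 'M[R]_d :=
  foldr (fun i B => mid i *m B) 1%:M (iota 0 k).

(* the factorization U_1 U_2 ... U_M, with U_1 = U1, U_{i+1} = mid (i-1) for
   0 < i < M-1, U_M = UM *)
Definition factor_prod (M m n d : nat) (U1 : 'M[R]_(m, d)) (mid : nat -> 'M[R]_d)
  (UM : 'M[R]_(d, n)) : 'M[R]_(m, n) := U1 *m mprod mid (M - 2) *m UM.

(* ||U_{i+1}||_{S_{pp i}} for the 0-based index i < M *)
Definition fnorm (M m n d : nat) (pp : nat -> R) (U1 : 'M[R]_(m, d))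
  (mid : nat -> 'M[R]_d) (UM : 'M[R]_(d, n)) (i : nat) : R :=
  if i == 0%N then schatten (pp i) U1
  else if i == M.-1 then schatten (pp i) UM
  else schatten (pp i) (mid i.-1).

End Schatten.

(* Main.v *)
Require Import Defs.
From HB Require Import structures.
From mathcomp Require Import all_boot all_order all_algebra perm.
From mathcomp Require Import all_classical all_reals.
From mathcomp Require Import sequences exp complex ring.
Set Implicit Arguments. Unset Strict Implicit. Unset Printing Implicit Defensive.
Import Order.TTheory GRing.Theory Num.Theory.
Local Open Scope ring_scope.

(* For nonincreasing singular values [s_i], [det ((A V)^T (A V)) <=
   (prod_(i < k) s_i(A))^2 det (V^T V)] for every [n x k] matrix [V], with equality
   on the top right singular vectors; applying this to one factor after the other
   gives Horn's inequality [prod_(i < k) s_i(X) <= prod_(i < k) prod_j s_i(U_j)].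
   Log-majorization turns it into
   [sum_i s_i(X)^p <= sum_i prod_j s_i(U_j)^p], and Hoelder's inequality and the
   weighted AM-GM inequality with weights [p / p_j] give the two lower bounds.
   Both are attained by splitting a singular value decomposition so that [U_j] has
   singular values [s_i(X)^(p / p_j)]. *)

(** * Spectral theorem for real symmetric matrices *)

Section RealSpectral.
Variable R : rcfType.

Lemma dotmx_sum n (u v : 'rV[R]_n) : (u *m v^T) 0 0 = \sum_i u 0 i * v 0 i.
Proof. by rewrite mxE; apply: eq_bigr => i _; rewrite mxE. Qed.

Lemma dotmx_ge0 n (u : 'rV[R]_n) : 0 <= (u *m u^T) 0 0.
Proof. by rewrite dotmx_sum sumr_ge0 // => i _; rewrite -expr2 sqr_ge0. Qed.

Lemma dotmx_eq0 n (u : 'rV[R]_n) : ((u *m u^T) 0 0 == 0) = (u == 0).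
Proof.
apply/idP/eqP => [|->]; last by rewrite mul0mx mxE.
rewrite dotmx_sum psumr_eq0 => [/allP u0|i _]; last by rewrite -expr2 sqr_ge0.
apply/rowP => i; rewrite mxE; apply/eqP.
by have := u0 i (mem_index_enum i); rewrite -expr2 sqrf_eq0.
Qed.

(** Over [R[i]] there is an eigenvector x + i y. Symmetry forces its eigenvalue to be real, and a
    real eigenvalue of the complexified matrix is one of [A]. *)
Lemma symmetric_eigenvalue n (A : 'M[R]_n.+1) :
  A^T = A -> exists a, eigenvalue A a.
Proof.
move=> symA; pose f := real_complex R.
have [z /eigenvalueP [v vA v0]] := @Theorem7' R n.+1 (map_mx f A) isT.
pose x := map_mx (@complex.Re R) v; pose y := map_mx (@complex.Im R) v.
have vE i : v 0 i = (x 0 i +i* y 0 i)%C by rewrite !mxE; case: (v 0 i).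
have ReM (t : R[i]) (b : R) : complex.Re (t * f b) = complex.Re t * b.
  by case: t => t1 t2; rewrite /= mulr0 subr0.
have ImM (t : R[i]) (b : R) : complex.Im (t * f b) = complex.Im t * b.
  by case: t => t1 t2; rewrite /= mulr0 add0r.
have xA : x *m A = complex.Re z *: x - complex.Im z *: y.
  apply/rowP => j; move/rowP: vA => /(_ j) /(congr1 (@complex.Re R)).
  rewrite !mxE raddf_sum /=; case: z (v 0 j) => [a b] [vj1 vj2] /= <-.
  by apply: eq_bigr => i _; rewrite !mxE ReM.
have yA : y *m A = complex.Im z *: x + complex.Re z *: y.
  apply/rowP => j; move/rowP: vA => /(_ j) /(congr1 (@complex.Im R)).
  rewrite !mxE raddf_sum /=; clear xA; case: z (v 0 j) => [a b] [vj1 vj2] /=.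
  rewrite addrC => <-.
  by apply: eq_bigr => i _; rewrite !mxE ImM.
have Im0 : complex.Im z = 0.
  (* [x A y^T], computed in two ways, gives [Im z * (|x|^2 + |y|^2) = 0]. *)
  have : x *m A *m y^T = x *m (y *m A)^T by rewrite trmx_mul symA mulmxA.
  rewrite xA yA [(_ + _)^T]raddfD /= ![(_ *: _)^T]linearZ /= mulmxBl mulmxDr.
  rewrite -!scalemxAl -!scalemxAr.
  rewrite addrC => /addIr /eqP; rewrite eq_sym -subr_eq0 opprK -scalerDr.
  rewrite scalemx_eq0 => /orP [/eqP //|/eqP/matrixP/(_ 0 0)/eqP].
  rewrite mxE [X in _ == X]mxE paddr_eq0 ?dotmx_ge0 // !dotmx_eq0 => /andP[/eqP x0 /eqP y0].
  by case/eqP: v0; apply/rowP => i; rewrite vE x0 y0 !mxE.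
exists (complex.Re z); rewrite -(eigenvalue_map f); apply/eigenvalueP; exists v => //.
by rewrite vA; congr (_ *: _); case: z Im0 {vA xA yA} => a b /= ->.
Qed.

(** Completes a unit vector to an orthonormal basis, for the deflation step below. Unless the vector
    is already the first basis vector, a single reflection does it. *)
Lemma orthogonal_with_first_row n (u : 'rV[R]_n.+1) :
  (u *m u^T) 0 0 = 1 ->
  exists2 H : 'M[R]_n.+1, H *m H^T = 1%:M & delta_mx 0 0 *m H = u.
Proof.
move=> u1; pose e : 'rV[R]_n.+1 := delta_mx 0 0; pose w := u - e.
have [w0|w0] := eqVneq w 0.
  by exists 1%:M; rewrite ?trmx1 ?mulmx1 //; move/eqP: w0; rewrite subr_eq0 => /eqP.
pose c := (w *m w^T) 0 0; have c0 : c != 0 by rewrite dotmx_eq0.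
have dotE (a b : 'rV[R]_n.+1) : a *m b^T = ((a *m b^T) 0 0)%:M by rewrite [LHS]mx11_scalar.
have ue : (u *m e^T) 0 0 = (e *m u^T) 0 0 by rewrite -[u in LHS]trmxK -trmx_mul mxE.
have ee : (e *m e^T) 0 0 = 1 by rewrite /e trmx_delta mul_delta_mx mxE eqxx.
have ew : (e *m w^T) 0 0 = - c / 2.
  have -> : (e *m w^T) 0 0 = (e *m u^T) 0 0 - (e *m e^T) 0 0.
    by rewrite !dotmx_sum -sumrB; apply: eq_bigr => i _; rewrite !mxE mulrBr.
  have -> : c = (u *m u^T) 0 0 - (u *m e^T) 0 0 - (e *m u^T) 0 0 + (e *m e^T) 0 0.
    rewrite /c !dotmx_sum -!sumrB -big_split /=; apply: eq_bigr => i _.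
    by rewrite !mxE; ring.
  by rewrite u1 ue ee; field.
have uw : e + w = u by rewrite addrC subrK.
clearbody w.
(* the Householder reflection exchanging [e] and [u] *)
pose H : 'M[R]_n.+1 := 1%:M - (2 / c) *: (w^T *m w).
have HT : H^T = H by rewrite /H linearB /= trmx1 linearZ /= trmx_mul trmxK.
exists H.
  rewrite HT {1}/H mulmxBl mul1mx /H mulmxBr mulmx1 -scalemxAl -scalemxAr.
  rewrite mulmxA -(mulmxA w^T) (dotE w w) -/c mul_mx_scalar -scalemxAl !scalerA.
  rewrite -[RHS](addr0 1%:M) -!addrA; congr (_ + _).
  rewrite opprB -!scaleNr -!scalerDl -[RHS](scale0r (w^T *m w)).
  by congr (_ *: _); field.
rewrite /H mulmxBr mulmx1 -scalemxAr mulmxA (dotE e w) ew mul_scalar_mx scalerA.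
rewrite (_ : 2 / c * _ = -1); last by field.
by rewrite scaleN1r opprK.
Qed.

(** Deflation: in an orthonormal basis starting with a unit eigenvector, the matrix splits into the
    eigenvalue and a smaller symmetric block. *)
Lemma symmetric_spectral n (A : 'M[R]_n) : A^T = A ->
  exists Q : 'M[R]_n, exists d : 'rV[R]_n,
    Q *m Q^T = 1%:M /\ A = Q^T *m diag_mx d *m Q.
Proof.
elim: n A => [|n IHn] A symA.
  by exists 0, 0; split; apply/matrixP => -[].
have [a /eigenvalueP [v vA v0]] := symmetric_eigenvalue symA.
pose c := (v *m v^T) 0 0.
have c_gt0 : 0 < c by rewrite lt_neqAle eq_sym dotmx_eq0 v0 dotmx_ge0.
pose u := (Num.sqrt c)^-1 *: v.
have u1 : (u *m u^T) 0 0 = 1.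
  rewrite /u linearZ /= -scalemxAl -scalemxAr scalerA mxE -/c.
  by rewrite -invfM -expr2 sqr_sqrtr ?ltW // mulVf ?gt_eqF.
have uA : u *m A = a *: u by rewrite /u -scalemxAl vA !scalerA mulrC.
have [H HH Hu] := orthogonal_with_first_row u1.
have HH' : H^T *m H = 1%:M by apply: mulmx1C.
pose B : 'M[R]_(1 + n) := H *m A *m H^T.
have symB : B^T = B by rewrite /B !trmx_mul trmxK symA mulmxA.
have Br : delta_mx 0 0 *m B = a *: delta_mx 0 0 :> 'rV_n.+1.
  by rewrite /B !mulmxA Hu uA -scalemxAl -Hu -mulmxA HH mulmx1.
have AB : A = H^T *m B *m H.
  by rewrite /B !mulmxA HH' mul1mx -mulmxA HH' mulmx1.
clearbody B.
(* By [Br] the first row vanishes off the diagonal; symmetry then clears the first column. *)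
have BE : B = block_mx a%:M 0 0 (drsubmx B).
  have B0 (j : 'I_(1 + n)) : B (lshift n 0) j = a * (j == lshift n 0)%:R.
    move/rowP: Br => /(_ j); rewrite -rowE !mxE eqxx /= -!val_eqE /= => <-.
    by congr (B _ _); apply: val_inj.
  have ur : ursubmx B = 0.
    by apply/rowP => j; rewrite !mxE B0 -val_eqE /= mulr0.
  rewrite -{1}[B]submxK ur; congr block_mx => //.
    by apply/matrixP => i j; rewrite !ord1 !mxE B0 eqxx mulr1.
  by rewrite -[dlsubmx B]trmxK trmx_dlsub symB ur trmx0.
have [|Q [d [QQ dE]]] := IHn (drsubmx B); first by rewrite trmx_drsub symB.
pose K : 'M[R]_(1 + n) := block_mx 1%:M 0 0 Q.
pose D : 'rV[R]_(1 + n) := row_mx a%:M d.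
have KT : K^T = block_mx 1%:M 0 0 Q^T by rewrite tr_block_mx !trmx0 trmx1.
have KK : K *m K^T = 1%:M.
  rewrite KT mulmx_block !(mulmx0, mul0mx, mulmx1, addr0, add0r) QQ.
  by rewrite -scalar_mx_block.
have KD : K^T *m diag_mx D *m K = B.
  rewrite KT diag_mx_row !mulmx_block.
  rewrite !(mulmx0, mul0mx, mulmx1, mul1mx, addr0, add0r) -dE [RHS]BE.
  by congr block_mx; apply/matrixP => i j; rewrite !ord1 !mxE.
exists (K *m (H : 'M[R]_(1 + n))), D; split.
  by rewrite trmx_mul mulmxA -(mulmxA K) HH mulmx1.
by rewrite AB -KD trmx_mul !mulmxA.
Qed.

End RealSpectral.

(** * Singular values *)

Lemma mul_tr_diagE (R : comPzRingType) n p (Q : 'M[R]_(n, p)) (d : 'rV[R]_n) i j :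
  (Q^T *m diag_mx d *m Q) i j = \sum_k Q k i * d 0 k * Q k j.
Proof.
rewrite mxE; apply: eq_bigr => k _; congr (_ * _).
by rewrite mul_mx_diag !mxE.
Qed.

Lemma symmetric_spectral_sorted (R : rcfType) n (A : 'M[R]_n) : A^T = A ->
  exists Q : 'M[R]_n, exists d : 'rV[R]_n,
    [/\ Q *m Q^T = 1%:M, A = Q^T *m diag_mx d *m Q &
        forall i j : 'I_n, (i <= j)%N -> d 0 j <= d 0 i].
Proof.
move=> /symmetric_spectral [Q [d [QQ AE]]].
pose t := [tuple d 0 i | i < n].
have ps : perm_eq (sort >=%R t) t by rewrite perm_sort.
have [s sE] := tuple_permP ps.
exists (row_perm s Q), (\row_i d 0 (s i)); split.
- rewrite row_permE trmx_mul mulmxA -(mulmxA _ Q) QQ mulmx1 tr_perm_mx -perm_mxM.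
  by rewrite mulgV perm_mx1.
- rewrite AE; apply/matrixP => i j; rewrite !mul_tr_diagE (reindex_perm s) /=.
  by apply: eq_bigr => k _; rewrite !mxE.
move=> i j ij; rewrite !mxE.
have tE (k : 'I_n) : nth 0 (sort >=%R t) k = d 0 (s k).
  by rewrite sE -tnth_nth !tnth_mktuple.
have ge_tr : transitive (>=%R : rel R) by move=> x y z xy yz; apply: le_trans yz xy.
have ge_tot : total (>=%R : rel R) by move=> x y; rewrite orbC le_total.
rewrite -!tE; apply: (sorted_leq_nth ge_tr (@lexx _ R) 0 (sort_sorted ge_tot _)) => //.
- by rewrite inE size_sort size_tuple.
- by rewrite inE size_sort size_tuple.
Qed.

Lemma char_poly_diag_conj (R : comNzRingType) n (Q : 'M[R]_n) (d : 'rV[R]_n) :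
  Q *m Q^T = 1%:M ->
  char_poly (Q^T *m diag_mx d *m Q) = \prod_i ('X - (d 0 i)%:P).
Proof.
move=> QQ; have QQ' := mulmx1C QQ.
transitivity (char_poly (diag_mx d)); last first.
  rewrite char_poly_trig ?diag_mx_is_trig //; apply: eq_bigr => i _.
  by rewrite mxE eqxx mulr1n.
pose P := map_mx polyC Q.
have PP : P^T *m P = 1%:M by rewrite /P map_trmx -map_mxM QQ' map_mx1.
rewrite /char_poly.
have -> : char_poly_mx (Q^T *m diag_mx d *m Q) = P^T *m char_poly_mx (diag_mx d) *m P.
  rewrite /char_poly_mx mulmxBr mulmxBl !map_mxM -map_trmx -/P; congr (_ - _).
  by rewrite -mulmxA mul_scalar_mx -scalemxAr PP scalemx1.
by rewrite !det_mulmx mulrAC -det_mulmx PP det1 mul1r.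
Qed.

(** Inverting the first r entries of [d] factors the partial identity of rank r through
    [diag_mx d]. *)
Lemma nonzero_prefix_rank_diag (F : fieldType) n (d : 'rV[F]_n) r : (r <= n)%N ->
  (forall i : 'I_n, (i < r)%N -> d 0 i != 0) -> (r <= \rank (diag_mx d))%N.
Proof.
move=> rn dn0.
have <- : \rank (pid_mx r : 'M[F]_n) = r by rewrite rank_pid_mx.
have -> : pid_mx r = diag_mx (\row_i if (i < r)%N then (d 0 i)^-1 else 0) *m diag_mx d.
  apply/matrixP => i j; rewrite mul_diag_mx !mxE.
  case: ifP => [ir|ir]; last by rewrite andbF mul0r.
  by rewrite andbT val_eqE; case: (i == j); rewrite ?mulr0 // mulr1n mulVf ?dn0.
exact: mxrankM_maxr.
Qed.

Section SingularSystem.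
Variable R : rcfType.

(* [l] lists the singular values in nonincreasing order, continued by zeros; the
   rows of [Q] are the right singular vectors. *)
Definition singular_system m n (A : 'M[R]_(m, n)) (l : nat -> R) (Q : 'M[R]_n) :=
  [/\ Q *m Q^T = 1%:M, A^T *m A = Q^T *m diag_mx (\row_i l i ^+ 2) *m Q,
      forall i j, (i <= j)%N -> l j <= l i, forall i, 0 <= l i &
      forall i, (\rank A <= i)%N -> l i = 0].

Lemma singular_system_exists m n (A : 'M[R]_(m, n)) :
  exists l Q, singular_system A l Q.
Proof.
have symS : (A^T *m A)^T = A^T *m A by rewrite trmx_mul trmxK.
have [Q [d [QQ AE d_sort]]] := symmetric_spectral_sorted symS.
have dE : diag_mx d = (A *m Q^T)^T *m (A *m Q^T).
  by rewrite trmx_mul trmxK mulmxA -(mulmxA Q) AE !mulmxA QQ mul1mx -mulmxA QQ mulmx1.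
have d_ge0 i : 0 <= d 0 i.
  have -> : d 0 i = diag_mx d i i by rewrite mxE eqxx mulr1n.
  by rewrite dE mxE sumr_ge0 // => k _; rewrite mxE -expr2 sqr_ge0.
pose l i := if insub i is Some k then Num.sqrt (d 0 (k : 'I_n)) else 0.
have lE (i : 'I_n) : l i = Num.sqrt (d 0 i) by rewrite /l valK.
have l0 i : (n <= i)%N -> l i = 0 by move=> ni; rewrite /l insubN // -leqNgt.
have l_ge0 i : 0 <= l i by rewrite /l; case: insubP => // *; rewrite sqrtr_ge0.
have l_sort i j : (i <= j)%N -> l j <= l i.
  move=> ij; case: (ltnP j n) => [jn|/l0 -> //].
  rewrite (lE (Ordinal jn)) (lE (Ordinal (leq_ltn_trans ij jn))).
  by rewrite ler_wsqrtr // d_sort.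
exists l, Q; split=> //.
  rewrite AE; congr (_ *m diag_mx _ *m _); apply/rowP => i.
  by rewrite mxE lE sqr_sqrtr.
move=> i ri; case: (ltnP i n) => [lt_in|/l0 //].
(* If [l i] were nonzero, monotonicity would make the first i + 1 entries of [d] nonzero, so
   [diag_mx d], and hence [A], would have rank above i. *)
apply/eqP; apply: contraLR ri => li0; rewrite -ltnNge.
apply: (@leq_trans (\rank (diag_mx d))).
  apply: nonzero_prefix_rank_diag => // j ji.
  have : 0 < l j.
    by rewrite (lt_le_trans _ (l_sort j i _)) // lt_neqAle eq_sym li0 l_ge0.
  by rewrite lE; apply: contraTneq => ->; rewrite sqrtr0 ltxx.
by rewrite dE; apply: leq_trans (mxrankM_maxr _ _) (mxrankM_maxl _ _).
Qed.

End SingularSystem.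

(** Passes from the definition by characteristic polynomials to any orthogonal diagonalization,
    sorted or not: both list the roots of one polynomial, so the squares agree up to permutation. *)
Lemma powR_sum_singular_values (R : realType) m n (A : 'M[R]_(m, n)) (Q : 'M[R]_n)
    (l : nat -> R) (q : R) :
  0 < q -> Q *m Q^T = 1%:M -> (forall i : 'I_n, 0 <= l i) ->
  A^T *m A = Q^T *m diag_mx (\row_i l i ^+ 2) *m Q ->
  \sum_(x <- singular_values A) x `^ q = \sum_(i < n) l i `^ q.
Proof.
move=> q0 QQ l_ge0 AE.
(* [xget] returns a genuine list of singular values only once one is known to exist. *)
have [s0 s0P] : exists s, is_singular_values A s.
  have [e [P [PP PE e_sort e_ge0 e0]]] := singular_system_exists A.
  exists (mkseq e (minn m n)); split; first by rewrite size_mkseq.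
    by apply/allP => x /mapP [i _ ->].
  rewrite PE char_poly_diag_conj // big_map.
  transitivity (\prod_(0 <= i < n) ('X - (e i ^+ 2)%:P)).
    by rewrite big_mkord; apply: eq_bigr => i _; rewrite mxE.
  rewrite (big_cat_nat (n := minn m n)) ?geq_minr //= mulrC /index_iota subn0.
  congr (_ * _); rewrite -prodr_const_nat; apply: eq_big_nat => i /andP[mi _].
  rewrite e0 ?expr0n /= ?subr0 //; apply: leq_trans mi.
  by rewrite leq_min rank_leq_row rank_leq_col.
have [s_size s_ge0 sE] := xgetPex [::] (ex_intro _ s0 s0P).
rewrite -/(singular_values A) in s_size s_ge0 sE.
set s := singular_values A in s_size s_ge0 sE *.
have /prod_XsubC_eq ps :
    \prod_(x <- [seq l i ^+ 2 | i : 'I_n]) ('X - x%:P) =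
    \prod_(x <- [seq x ^+ 2 | x <- s] ++ nseq (n - minn m n) 0) ('X - x%:P).
  rewrite big_cat /= big_image /= big_map big_nseq subr0 iter_mulr_1 mulrC -sE.
  rewrite AE char_poly_diag_conj //; apply: eq_bigr => i _.
  by rewrite mxE.
(* The padding zeros contribute nothing, because 0 to a positive power is 0. *)
transitivity (\sum_(x <- [seq x ^+ 2 | x <- s] ++ nseq (n - minn m n) 0) Num.sqrt x `^ q).
  rewrite big_cat big_map /= big_nseq sqrtr0 powR0 ?gt_eqF //.
  rewrite iter_addr_0 mul0rn addr0; apply: eq_big_seq => x xs.
  by rewrite sqrtr_sqr ger0_norm // (allP s_ge0).
rewrite -(perm_big _ ps) /= big_image /=; apply: eq_bigr => i _.
by rewrite sqrtr_sqr ger0_norm.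
Qed.

(** * Determinantal characterization of products of singular values *)

(* Cauchy-Binet, summed over all index maps [f] instead of over [k]-subsets:
   every subset is then counted [k!] times, and noninjective [f] contribute 0. *)
Lemma det_tr_diag_mul (R : comPzRingType) n k (V : 'M[R]_(n, k)) (d : 'rV[R]_n) :
  k`!%:R * \det (V^T *m diag_mx d *m V) =
  \sum_(f : {ffun 'I_k -> 'I_n}) (\prod_i d 0 (f i)) * \det (rowsub f V) ^+ 2.
Proof.
have detE : \det (V^T *m diag_mx d *m V) =
    \sum_(f : {ffun 'I_k -> 'I_n})
      (\prod_i d 0 (f i)) * ((\prod_i V (f i) i) * \det (rowsub f V)).
  under [RHS]eq_bigr => f _ do rewrite mulrA big_distrr /=.
  rewrite exchange_big /=; apply: eq_bigr => s _.
  under eq_bigr => i _ do rewrite mul_tr_diagE.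
  rewrite bigA_distr_bigA /= big_distrr /=; apply: eq_bigr => f _.
  rewrite mulrCA -!big_split /=; congr (_ * _); apply: eq_bigr => i _.
  by rewrite mxE; ring.
(* The factor k! becomes a sum over permutations t. In the copy for t, replacing f by f o t keeps
   the weight and multiplies the minor by the sign of t; summed over t, the signed products form the
   second determinant. *)
rewrite mulr_natl -card_Sn -sumr_const.
transitivity (\sum_(t : 'S_k) \sum_(f : {ffun 'I_k -> 'I_n})
    (\prod_i d 0 (f i)) * \det (rowsub f V) * ((-1) ^+ t * \prod_i V (f (t i)) i)).
  apply: eq_bigr => t _; rewrite detE.
  pose g (s : 'S_k) (f : {ffun 'I_k -> 'I_n}) := [ffun i => f (s i)].
  have gK s : cancel (g s) (g s^-1%g) by move=> f; apply/ffunP => i; rewrite !ffunE permKV.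
  have gKV s : cancel (g s^-1%g) (g s) by move=> f; apply/ffunP => i; rewrite !ffunE permK.
  rewrite (reindex (g t)) /=; last by exists (g t^-1%g) => f _; rewrite (gK, gKV).
  apply: eq_bigr => f _.
  have -> : rowsub (g t f) V = row_perm t (rowsub f V).
    by apply/matrixP => i j; rewrite !mxE ffunE.
  have -> : \prod_i d 0 (g t f i) = \prod_i d 0 (f i).
    by rewrite [RHS](reindex_perm t); apply: eq_bigr => i _; rewrite ffunE.
  have -> : \prod_i V (g t f i) i = \prod_i V (f (t i)) i.
    by apply: eq_bigr => i _; rewrite ffunE.
  rewrite row_permE det_mulmx det_perm -[RHS]mulrA; congr (_ * _).
  by rewrite [LHS]mulrCA [RHS]mulrCA [X in _ * X]mulrC.
rewrite exchange_big /=; apply: eq_bigr => f _.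
rewrite -big_distrr /= expr2 mulrA; congr (_ * _).
rewrite -[RHS]det_tr; apply: eq_bigr => t _; congr (_ * _).
by apply: eq_bigr => i _; rewrite !mxE.
Qed.

(** Once the k distinct indices are sorted, the i-th one is at least i, so the comparison holds
    factor by factor. *)
Lemma prod_injective_le (R : realDomainType) (l : nat -> R) n k (f : 'I_k -> 'I_n) :
  (forall i, 0 <= l i) -> (forall i j, (i <= j)%N -> l j <= l i) -> injective f ->
  \prod_(i < k) l (f i) <= \prod_(i < k) l i.
Proof.
move=> l_ge0 l_sort f_inj.
pose s := sort leq [seq val (f i) | i : 'I_k].
have s_size : size s = k by rewrite size_sort size_image card_ord.
have s_sort : sorted ltn s.
  rewrite ltn_sorted_uniq_leq sort_uniq sort_sorted ?andbT; last exact: leq_total.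
  by rewrite map_inj_uniq ?enum_uniq // => i j /val_inj /f_inj.
have s_ge i : (i < k)%N -> (i <= nth 0%N s i)%N.
  elim: i => // i IH ik; apply: leq_ltn_trans (IH (ltnW ik)) _.
  by apply: (sorted_ltn_nth ltn_trans) => //; rewrite inE s_size // ltnW.
have -> : \prod_(i < k) l (f i) = \prod_(x <- s) l x.
  by rewrite (perm_big _ (permEl (perm_sort _ _))) /= big_image.
rewrite (big_nth 0%N) s_size big_mkord; apply: ler_prod => i _.
by rewrite l_ge0 l_sort ?s_ge.
Qed.

(** In the coordinates W = Q V both determinants are Cauchy-Binet sums over the same squared minors,
    with weights that compare term by term; a noninjective [f] repeats a row and its minor is 0. *)
Lemma det_singular_le (R : rcfType) m n k (A : 'M[R]_(m, n)) l Q (V : 'M[R]_(n, k)) :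
  singular_system A l Q ->
  \det ((A *m V)^T *m (A *m V)) <= \prod_(i < k) l i ^+ 2 * \det (V^T *m V).
Proof.
move=> [QQ AE l_sort l_ge0 _]; have QQ' := mulmx1C QQ.
pose W := Q *m V.
have -> : (A *m V)^T *m (A *m V) = W^T *m diag_mx (\row_i l i ^+ 2) *m W.
  by rewrite /W !trmx_mul !mulmxA -(mulmxA V^T A^T) AE !mulmxA.
have -> : V^T *m V = W^T *m diag_mx (const_mx 1) *m W.
  by rewrite diag_const_mx mulmx1 /W trmx_mul mulmxA -(mulmxA V^T) QQ' mulmx1.
have k_gt0 : 0 < k`!%:R :> R by rewrite ltr0n fact_gt0.
rewrite -(ler_pM2l k_gt0) det_tr_diag_mul mulrCA det_tr_diag_mul big_distrr /=.
apply: ler_sum => f _.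
have -> : \prod_i (const_mx 1 : 'rV[R]_n) 0 (f i) = 1.
  by rewrite big1 // => i _; rewrite mxE.
rewrite mul1r; have [/injectiveP f_inj|/injectivePn [i [j ij fij]]] := boolP (injectiveb f).
  rewrite ler_wpM2r ?sqr_ge0 //; under eq_bigr => i _ do rewrite mxE.
  apply: (prod_injective_le (l := fun i => l i ^+ 2)) => // [i|i j ij].
    by rewrite sqr_ge0.
  by rewrite lerXn2r ?nnegrE ?l_sort.
have -> : \det (rowsub f W) = 0; last by rewrite expr0n !mulr0.
by rewrite (determinant_alternate ij) // => c; rewrite !mxE fij.
Qed.

Lemma det_singular_attained (R : rcfType) m n k (A : 'M[R]_(m, n)) l Q :
  singular_system A l Q -> (k <= n)%N ->
  exists V : 'M[R]_(n, k), V^T *m V = 1%:M /\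
    \det ((A *m V)^T *m (A *m V)) = \prod_(i < k) l i ^+ 2.
Proof.
move=> [QQ AE _ _ _] kn; pose w := widen_ord kn.
have w_inj : injective w by move=> i j /(congr1 val) /= /val_inj.
pose E : 'M[R]_(k, n) := rowsub w 1%:M.
have EE : E *m E^T = 1%:M.
  rewrite trmx_mxsub trmx1 mul_rowsub_mx mul1mx; apply/matrixP => i j.
  by rewrite !mxE (inj_eq w_inj).
exists (E *m Q)^T; rewrite !trmxK; split.
  by rewrite trmx_mul mulmxA -(mulmxA E) QQ mulmx1.
have -> : (A *m (E *m Q)^T)^T *m (A *m (E *m Q)^T) = diag_mx (\row_(i < k) l i ^+ 2).
  rewrite !trmx_mul !trmxK !mulmxA -(mulmxA _ A^T) AE !mulmxA -(mulmxA E) QQ mulmx1.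
  rewrite -(mulmxA _ Q) QQ mulmx1 trmx_mxsub trmx1 mul_rowsub_mx mul1mx mulmx_colsub mulmx1.
  by apply/matrixP => i j; rewrite !mxE /= (inj_eq w_inj).
by rewrite det_diag; apply: eq_bigr => i _; rewrite mxE.
Qed.

(** * Power inequalities *)

Section PowerInequalities.
Variable R : realType.

Lemma powR_prod (I : Type) (r : seq I) (P : pred I) (F : I -> R) (q : R) :
  (forall i, P i -> 0 <= F i) ->
  (\prod_(i <- r | P i) F i) `^ q = \prod_(i <- r | P i) F i `^ q.
Proof.
move=> F_ge0; suff [] : 0 <= \prod_(i <- r | P i) F i /\
    (\prod_(i <- r | P i) F i) `^ q = \prod_(i <- r | P i) F i `^ q by [].
elim/big_ind2: _ => [|x1 x2 y1 y2 [x1_ge0 <-] [y1_ge0 <-]|i Pi].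
- by rewrite ler01 powR1.
- by rewrite mulr_ge0 // powRM.
- by rewrite F_ge0.
Qed.

(** Weighted AM-GM. After division by the mean [S], the bound x <= exp(x - 1) applies to each
    factor, and the exponents w_i (a_i / S - 1) add up to 0. *)
Lemma prod_powR_le_weighted_sum (I : finType) (w a : I -> R) :
  (forall i, 0 < w i) -> (forall i, 0 <= a i) -> \sum_i w i = 1 ->
  \prod_i a i `^ w i <= \sum_i w i * a i.
Proof.
move=> w_gt0 a_ge0 w1; set S := \sum_i _.
have S_ge0 : 0 <= S by apply: sumr_ge0 => i _; rewrite mulr_ge0 // ltW.
(* When S = 0 every a_i is 0; the weights sum to 1, so an index exists and the product vanishes
   too. *)
have [S0|S_neq0] := eqVneq S 0.
  have [i0 _|I0] := pickP (@predT I); last first.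
    move: w1; rewrite big1 => [/eqP|i _]; last by have := I0 i.
    by rewrite eq_sym oner_eq0.
  have /eqP : S = 0 := S0; rewrite psumr_eq0 => [/allP /(_ i0)|i _]; last first.
    by rewrite mulr_ge0 // ltW.
  rewrite mem_index_enum mulf_eq0 gt_eqF //= => /(_ isT)/eqP ai0.
  by rewrite (bigD1 i0) //= ai0 powR0 ?gt_eqF // mul0r S0.
have S_gt0 : 0 < S by rewrite lt_neqAle eq_sym S_neq0.
have aS i : a i = S * (a i / S) by rewrite mulrC divfK.
have aS_ge0 i : 0 <= a i / S by rewrite divr_ge0.
under eq_bigr => i _ do rewrite aS powRM //.
rewrite big_split /= -[leRHS]mulr1.
have -> : \prod_i S `^ w i = S.
  rewrite /powR gt_eqF //; under eq_bigr do [].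
  by rewrite -expR_sum -mulr_suml w1 mul1r lnK // posrE.
rewrite ler_pM2l //.
apply: (@le_trans _ _ (\prod_i expR (w i * (a i / S - 1)))).
  apply: ler_prod => i _; rewrite powR_ge0 /= [w i * _]mulrC expRM.
  apply: ge0_ler_powR; rewrite ?nnegrE ?expR_ge0 ?(ltW (w_gt0 i)) //.
  by have := expR_ge1Dx (a i / S - 1); rewrite addrC subrK.
rewrite -expR_sum expR_le1.
under eq_bigr => i _ do rewrite mulrBr mulr1 mulrA.
by rewrite sumrB -mulr_suml -/S divff // w1 subrr.
Qed.

(** Scale each column [a _ j] to have sum 1, apply AM-GM for each i, and exchange the sums. *)
Lemma generalized_holder (I J : finType) (w : J -> R) (a : I -> J -> R) :
  (forall j, 0 < w j) -> (forall i j, 0 <= a i j) -> \sum_j w j = 1 ->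
  \sum_i \prod_j a i j `^ w j <= \prod_j (\sum_i a i j) `^ w j.
Proof.
move=> w_gt0 a_ge0 w1; pose N j := \sum_i a i j.
have N_ge0 j : 0 <= N j by apply: sumr_ge0.
(* A column with sum 0 cannot be scaled, but its entries are all 0, which kills the left side. *)
have [[j Nj]|N_neq0] := pselect (exists j, N j = 0).
  rewrite big1 => [|i _]; first by apply: prodr_ge0 => j' _; apply: powR_ge0.
  have /eqP := Nj; rewrite psumr_eq0 // => /allP /(_ i (mem_index_enum i)) /= /eqP aij.
  by rewrite (bigD1 j) //= aij powR0 ?gt_eqF // mul0r.
have N_gt0 j : 0 < N j.
  by rewrite lt_neqAle N_ge0 andbT eq_sym; apply/eqP => Nj; apply: N_neq0; exists j.
have aN i j : a i j = N j * (a i j / N j) by rewrite mulrC divfK ?gt_eqF.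
have aN_ge0 i j : 0 <= a i j / N j by rewrite divr_ge0.
have -> : \sum_i \prod_j a i j `^ w j =
    \sum_i (\prod_j N j `^ w j * \prod_j (a i j / N j) `^ w j).
  apply: eq_bigr => i _; rewrite -big_split; apply: eq_bigr => j _ /=.
  by rewrite -powRM // -aN.
rewrite -mulr_sumr -[leRHS]mulr1 ler_wpM2l //.
  by apply: prodr_ge0 => j _; apply: powR_ge0.
apply: (@le_trans _ _ (\sum_i \sum_j w j * (a i j / N j))).
  by apply: ler_sum => i _; apply: prod_powR_le_weighted_sum.
rewrite exchange_big /= -w1; apply: ler_sum => j _.
by rewrite -mulr_sumr -mulr_suml -/(N j) divff ?mulr1 ?gt_eqF.
Qed.

Lemma abel_sum_ge0 (c u : nat -> R) n :
  (forall i j, (i <= j)%N -> c j <= c i) -> (forall i, 0 <= c i) ->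
  (forall k, (k <= n)%N -> 0 <= \sum_(i < k) u i) ->
  0 <= \sum_(i < n) c i * u i.
Proof.
move=> c_sort c_ge0; case: n => [|n] u_ge0; first by rewrite big_ord0.
(* In the induction, replacing c_k by the smaller c_(k+1) only lowers the bound, because the partial
   sum of u is nonnegative. *)
suff H k : (k <= n)%N -> c k * \sum_(i < k.+1) u i <= \sum_(i < k.+1) c i * u i.
  by apply: le_trans (H n (leqnn n)); rewrite mulr_ge0 // u_ge0.
elim: k => [|k IH] kn; first by rewrite !big_ord1.
rewrite big_ord_recr [leRHS]big_ord_recr /= mulrDr lerD2r.
apply: le_trans (IH (ltnW kn)); apply: ler_wpM2r (c_sort _ _ (leqnSn k)).
by rewrite u_ge0 // ltnW.
Qed.

(* Convexity of [exp]: [y^p - x^p >= p x^p (ln y - ln x)], and the weights [x^p]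
   decrease, so summation by parts applies to [ln y - ln x]. *)
Lemma log_majorization_sum_powR (x y : nat -> R) n p :
  0 < p -> (forall i, 0 <= x i) -> (forall i j, (i <= j)%N -> x j <= x i) ->
  (forall i, 0 <= y i) ->
  (forall k, (k <= n)%N -> \prod_(i < k) x i <= \prod_(i < k) y i) ->
  \sum_(i < n) x i `^ p <= \sum_(i < n) y i `^ p.
Proof.
move=> p_gt0 x_ge0 x_sort y_ge0; elim: n => [|n IH] xy; first by rewrite !big_ord0.
(* Logarithms need positive entries. A zero last x drops out of the left sum; otherwise monotonicity
   makes all x positive, and the full product inequality makes all y positive. *)
have [xn0|xn_neq0] := eqVneq (x n) 0.
  rewrite big_ord_recr /= xn0 powR0 ?gt_eqF // addr0 big_ord_recr /=.
  by rewrite (le_trans (IH _)) ?lerDl ?powR_ge0 // => k kn; apply: xy; apply: leqW.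
have x_gt0 i : (i <= n)%N -> 0 < x i.
  by move=> ii; apply: lt_le_trans (x_sort _ _ ii); rewrite lt_neqAle eq_sym xn_neq0 x_ge0.
have y_gt0 i : (i <= n)%N -> 0 < y i.
  move=> ii; rewrite lt_neqAle y_ge0 andbT eq_sym; apply/eqP => yi0.
  have := xy n.+1 (leqnn _); rewrite [leRHS](bigD1 (inord i)) //= inordK // yi0 mul0r.
  by rewrite leNgt prodr_gt0 // => j _; rewrite x_gt0 // -ltnS.
rewrite -subr_ge0 -sumrB.
apply: (@le_trans _ _ (\sum_(i < n.+1) x i `^ p * (p * (ln (y i) - ln (x i))))).
  apply: (@abel_sum_ge0 (fun i => x i `^ p) (fun i => p * (ln (y i) - ln (x i)))).
  - by move=> i j ij; apply: ge0_ler_powR; rewrite ?nnegrE ?x_sort // ltW.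
  - by move=> i; apply: powR_ge0.
  move=> k kn; rewrite -mulr_sumr mulr_ge0 ?(ltW p_gt0) // sumrB subr_ge0.
  rewrite -ler_expR !expR_sum.
  have lnE (z : nat -> R) : (forall i, (i <= n)%N -> 0 < z i) ->
      \prod_(i < k) expR (ln (z i)) = \prod_(i < k) z i.
    move=> z_gt0; apply: eq_bigr => i _; rewrite lnK // posrE z_gt0 //.
    by rewrite -ltnS (leq_trans (ltn_ord i) kn).
  by rewrite !lnE // xy.
apply: ler_sum => i _; have ii : (i <= n)%N by rewrite -ltnS.
have yE : y i `^ p = x i `^ p * expR (p * (ln (y i) - ln (x i))).
  by rewrite /powR !gt_eqF ?x_gt0 ?y_gt0 // -expRD; congr expR; ring.
rewrite yE -[X in _ <= _ - X]mulr1 -mulrBr ler_wpM2l ?powR_ge0 // lerBrDl.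
exact: expR_ge1Dx.
Qed.

End PowerInequalities.

(** * Horn's inequality and the lower bound *)

Section LowerBound.
Variable R : realType.

(** A sequence over all of [nat], so that factors of different sizes can be multiplied index by
    index. *)
Definition svals m n (A : 'M[R]_(m, n)) : nat -> R :=
  projT1 (cid (singular_system_exists A)).

Lemma svalsP m n (A : 'M[R]_(m, n)) : exists Q, singular_system A (svals A) Q.
Proof. exact: projT2 (cid (singular_system_exists A)). Qed.

Lemma svals_ge0 m n (A : 'M[R]_(m, n)) i : 0 <= svals A i.
Proof. by have [Q []] := svalsP A. Qed.

Lemma svals_sorted m n (A : 'M[R]_(m, n)) i j : (i <= j)%N -> svals A j <= svals A i.
Proof. by have [Q [_ _ + _ _]] := svalsP A; apply. Qed.

Lemma svals_eq0 m n (A : 'M[R]_(m, n)) i : (\rank A <= i)%N -> svals A i = 0.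
Proof. by have [Q [_ _ _ _ +]] := svalsP A; apply. Qed.

Lemma schattenE m n (A : 'M[R]_(m, n)) q : 0 < q ->
  schatten q A = (\sum_(i < n) svals A i `^ q) `^ q^-1.
Proof.
move=> q0; have [Q [QQ AE _ l_ge0 _]] := svalsP A.
by rewrite /schatten (powR_sum_singular_values q0 QQ _ AE).
Qed.

(** The cutoff [N] is independent of the width of [A]: the sums for all factors run over the n
    indices of the product, whereas most factors have width d. *)
Lemma sum_svals_le m n (A : 'M[R]_(m, n)) q N : 0 < q ->
  \sum_(i < N) svals A i `^ q <= schatten q A `^ q.
Proof.
move=> q0; rewrite schattenE // -powRrM mulVf ?gt_eqF // powRr1; last first.
  by apply: sumr_ge0 => i _; apply: powR_ge0.
rewrite -(big_mkord xpredT (fun i => svals A i `^ q)).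
rewrite -(big_mkord xpredT (fun i => svals A i `^ q)).
have [Nn|nN] := leqP N n.
  rewrite (big_cat_nat (n := N) (p := n)) //= lerDl.
  by apply: sumr_ge0 => i _; apply: powR_ge0.
rewrite (big_cat_nat (n := n) (p := N)) //= 1?ltnW // gerDl big_nat big1 // => i /andP[ni _].
by rewrite svals_eq0 ?powR0 ?gt_eqF // (leq_trans (rank_leq_col A)).
Qed.

Lemma det_svals_le m n k (A : 'M[R]_(m, n)) (V : 'M[R]_(n, k)) :
  \det ((A *m V)^T *m (A *m V)) <= (\prod_(i < k) svals A i) ^+ 2 * \det (V^T *m V).
Proof. by have [Q AQ] := svalsP A; rewrite -prodrXl; apply: det_singular_le AQ. Qed.

Lemma det_svals_foldr_le d k (mid : nat -> 'M[R]_d) (s : seq nat) (V : 'M[R]_(d, k)) :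
  let P := foldr (fun i B => mid i *m B) 1%:M s in
  \det ((P *m V)^T *m (P *m V)) <=
  (\prod_(j <- s) \prod_(i < k) svals (mid j) i) ^+ 2 * \det (V^T *m V).
Proof.
elim: s => [|j s IH] /=; first by rewrite big_nil expr1n mul1r mul1mx.
rewrite big_cons exprMn -mulrA -mulmxA.
by apply: le_trans (det_svals_le _ _) _; rewrite ler_wpM2l ?sqr_ge0.
Qed.

Definition factor_svals (M m n d : nat) (U1 : 'M[R]_(m, d)) (mid : nat -> 'M[R]_d)
    (UM : 'M[R]_(d, n)) (i : nat) : nat -> R :=
  if i == 0%N then svals U1
  else if i == M.-1 then svals UM
  else svals (mid i.-1).

Lemma factor_svals_ge0 M m n d (U1 : 'M[R]_(m, d)) mid (UM : 'M[R]_(d, n)) j i :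
  0 <= factor_svals M U1 mid UM j i.
Proof. by rewrite /factor_svals; do 2?case: ifP => _; apply: svals_ge0. Qed.

Lemma sum_factor_svals_le M m n d (pp : nat -> R) (U1 : 'M[R]_(m, d)) mid
    (UM : 'M[R]_(d, n)) j N : 0 < pp j ->
  \sum_(i < N) factor_svals M U1 mid UM j i `^ pp j <= fnorm M pp U1 mid UM j `^ pp j.
Proof. by rewrite /factor_svals /fnorm => pj; do 2?case: ifP => _; apply: sum_svals_le. Qed.

(* Horn's inequality for several factors. *)
Lemma prod_svals_factor_prod_le M m n d (U1 : 'M[R]_(m, d)) mid (UM : 'M[R]_(d, n)) k :
  (2 <= M)%N -> (k <= n)%N ->
  \prod_(i < k) svals (factor_prod M U1 mid UM) i <=
  \prod_(i < k) \prod_(j < M) factor_svals M U1 mid UM j i.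
Proof.
case: M => [|[|M]] // _ kn; set X := factor_prod _ _ _ _.
have fs_ge0 := factor_svals_ge0 M.+2 U1 mid UM.
rewrite -ler_sqr ?nnegrE; first last.
- by apply: prodr_ge0 => i _; apply: prodr_ge0 => j _; apply: fs_ge0.
- by apply: prodr_ge0 => i _; apply: svals_ge0.
have [Q XQ] := svalsP X.
(* On this [V] the squared left side is the Gram determinant of X V. The factors are peeled off from
   the left, and V^T V = 1 remains. *)
have [V [VV detV]] := det_singular_attained XQ kn.
rewrite -prodrXl -detV /X /factor_prod -!mulmxA.
apply: le_trans (det_svals_le _ _) _.
rewrite exchange_big /=; set F := fun j => \prod_(i < k) factor_svals M.+2 U1 mid UM j i.
rewrite -[X in _ <= X ^+ 2]/(\prod_(j < M.+2) F j) big_ord_recl big_ord_recr /=.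
rewrite exprMn ler_wpM2l ?sqr_ge0 //.
apply: le_trans (det_svals_foldr_le _ _ _) _.
rewrite !subSS subn0 exprMn.
(* The middle matrix [mid j] is the factor with index j + 1, which is [bump 0 j]. *)
have -> : \prod_(j <- iota 0 M) \prod_(i < k) svals (mid j) i =
    \prod_(j < M) F (bump 0 j).
  rewrite -[M in iota _ M]subn0 -/(index_iota 0 M) big_mkord; apply: eq_bigr => j _.
  by rewrite /F /factor_svals /bump /= add1n eqSS ltn_eqF.
rewrite ler_wpM2l ?sqr_ge0 //; apply: le_trans (det_svals_le _ _) _.
by rewrite VV det1 mulr1 /F /factor_svals /bump /= add1n eqxx.
Qed.

(** Horn's inequality, log-majorization, then Hoelder with weights p / p_j. The right side keeps the
    powers [fnorm j ^ pp j] apart, so that both lower bounds follow from it. *)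
Lemma sum_svals_factor_prod_le M m n d (pp : nat -> R) p (U1 : 'M[R]_(m, d)) mid
    (UM : 'M[R]_(d, n)) :
  (2 <= M)%N -> 0 < p -> (forall i, (i < M)%N -> 0 < pp i) ->
  \sum_(i < M) (pp i)^-1 = p^-1 ->
  \sum_(i < n) svals (factor_prod M U1 mid UM) i `^ p <=
  \prod_(j < M) (fnorm M pp U1 mid UM j `^ pp j) `^ (p / pp j).
Proof.
move=> M2 p_gt0 pp_gt0 pp_sum; set fs := factor_svals M U1 mid UM.
have pp_ord (j : 'I_M) : 0 < pp j by apply: pp_gt0.
have fs_ge0 : forall j i, 0 <= fs j i := factor_svals_ge0 M U1 mid UM.
apply: (@le_trans _ _ (\sum_(i < n) (\prod_(j < M) fs j i) `^ p)).
  apply: (@log_majorization_sum_powR R _ (fun i => \prod_(j < M) fs j i)) => //.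
  - exact: svals_ge0.
  - exact: svals_sorted.
  - by move=> i; apply: prodr_ge0.
  - by move=> k kn; apply: prod_svals_factor_prod_le.
apply: (@le_trans _ _ (\prod_(j < M) (\sum_(i < n) fs j i `^ pp j) `^ (p / pp j))).
  have := @generalized_holder R 'I_n 'I_M (fun j => p / pp j) (fun i j => fs j i `^ pp j).
  move=> /(_ (fun j => divr_gt0 p_gt0 (pp_ord j)) (fun i j => powR_ge0 _ _)).
  rewrite -mulr_sumr pp_sum divff ?gt_eqF // => /(_ erefl).
  congr (_ <= _); apply: eq_bigr => i _; rewrite powR_prod //.
  by apply: eq_bigr => j _; rewrite -powRrM mulrC divfK ?gt_eqF.
apply: ler_prod => j _; rewrite powR_ge0 /=.
apply: ge0_ler_powR; rewrite ?nnegrE ?powR_ge0 //.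
- by rewrite ltW // divr_gt0.
- by apply: sumr_ge0 => i _; apply: powR_ge0.
- exact: sum_factor_svals_le.
Qed.

End LowerBound.

(** * Attainment *)

Section Attainment.
Variable R : realType.

Definition rect_id d n : 'M[R]_(d, n) := \matrix_(i, j) (i == j :> nat)%:R.

Definition diagf n (f : nat -> R) : 'M[R]_n := diag_mx (\row_i f i).

Lemma tr_rect_id d n : (rect_id d n)^T = rect_id n d.
Proof. by apply/matrixP => i j; rewrite !mxE eq_sym. Qed.

Lemma mul_diagf n f g : diagf n f *m diagf n g = diagf n (fun i => f i * g i).
Proof. by rewrite mulmx_diag; congr diag_mx; apply/rowP => i; rewrite !mxE. Qed.

Lemma tr_diagf n f : (diagf n f)^T = diagf n f.
Proof. exact: tr_diag_mx. Qed.

Lemma eq_diagf n f g : f =1 g -> diagf n f = diagf n g.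
Proof. by move=> fg; congr diag_mx; apply/rowP => i; rewrite !mxE. Qed.

(** Nothing is lost in passing through width d when [f] vanishes from d on. It holds for either
    order of d and n, and is used in both directions. *)
Lemma rect_id_diagf d n f : (forall i, (d <= i)%N -> f i = 0) ->
  rect_id n d *m diagf d f *m rect_id d n = diagf n f.
Proof.
move=> f0; rewrite -tr_rect_id; apply/matrixP => i j; rewrite mul_tr_diagE !mxE.
have [id|di] := ltnP i d.
  rewrite (bigD1 (Ordinal id)) //= big1 => [|k]; last first.
    by rewrite -val_eqE /= !mxE => /negPf ->; rewrite !mul0r.
  by rewrite !mxE eqxx mul1r addr0 mulr_natr.
rewrite f0 // mul0rn big1 // => k _; rewrite !mxE.
by rewrite ltn_eqF ?mul0r // (leq_trans (ltn_ord k)).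
Qed.

Lemma schatten_diagf m n (A : 'M[R]_(m, n)) Q f q :
  0 < q -> Q *m Q^T = 1%:M -> (forall i, 0 <= f i) ->
  A^T *m A = Q^T *m diagf n (fun i => f i ^+ 2) *m Q ->
  schatten q A = (\sum_(i < n) f i `^ q) `^ q^-1.
Proof.
by move=> q0 QQ f0 AE; rewrite /schatten (powR_sum_singular_values q0 QQ _ AE).
Qed.

Lemma sum_vanishing (f : nat -> R) a b r :
  (r <= a)%N -> (r <= b)%N -> (forall i, (r <= i)%N -> f i = 0) ->
  \sum_(i < a) f i = \sum_(i < b) f i.
Proof.
move=> + + f0; suff H c : (r <= c)%N -> \sum_(i < c) f i = \sum_(i < r) f i.
  by move=> /H -> /H ->.
move=> rc; rewrite -!(big_mkord xpredT) (big_cat_nat (n := r)) //=.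
by rewrite [X in _ + X]big_nat [X in _ + X]big1 ?addr0 // => i /andP[/f0].
Qed.

Lemma mprod_diagf d (f : nat -> nat -> R) k :
  mprod (fun j => diagf d (f j)) k = diagf d (fun i => \prod_(j < k) f j i).
Proof.
rewrite /mprod.
have -> s : foldr (fun i B => diagf d (f i) *m B) 1%:M s =
    diagf d (fun i => \prod_(j <- s) f j i).
  elim: s => [|j s /= ->].
    rewrite -diag_const_mx; congr diag_mx; apply/rowP => i.
    by rewrite !mxE big_nil.
  by rewrite mul_diagf; apply: eq_diagf => i; rewrite big_cons.
by apply: eq_diagf => i; rewrite -[k in iota _ k]subn0 -/(index_iota 0 k) big_mkord.
Qed.

(* With [X^T X = Q^T diag(l^2) Q] the factors are [U_1 = X Q^T diag(l^(p/p_1 - 1))],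
   [diag(l^(p/p_j))] in the middle and [U_M = diag(l^(p/p_M)) Q], cut to width [d];
   where [l = 0] the quotient [g] below is the junk value [0 / 0 = 0]. *)
Lemma balanced_factorization M m n d (X : 'M[R]_(m, n)) (pp : nat -> R) p :
  (\rank X <= d)%N -> (2 <= M)%N -> 0 < p -> (forall i, (i < M)%N -> 0 < pp i) ->
  \sum_(i < M) (pp i)^-1 = p^-1 ->
  exists U1 : 'M[R]_(m, d), exists mid, exists UM : 'M[R]_(d, n),
    factor_prod M U1 mid UM = X /\
    forall j, (j < M)%N -> fnorm M pp U1 mid UM j =
      (\sum_(i < n) svals X i `^ p) `^ (pp j)^-1.
Proof.
case: M => [|[|M]] // rd _ p_gt0 pp_gt0 pp_sum.
have [Q XQ] := svalsP X; set l := svals X in XQ *.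
have [QQ XE _ l_ge0 l0] := XQ; have QQ' := mulmx1C QQ.
have rn := rank_leq_col X.
have ld i : (d <= i)%N -> l i = 0 by move=> di; apply/l0/(leq_trans rd).
have ln i : (n <= i)%N -> l i = 0 by move=> ni; apply/l0/(leq_trans rn).
pose e j i := l i `^ (p / pp j).
have w_gt0 j : (j < M.+2)%N -> 0 < p / pp j by move=> jM; rewrite divr_gt0 ?pp_gt0.
have e_ge0 j i : 0 <= e j i by apply: powR_ge0.
have e0 j i : (j < M.+2)%N -> l i = 0 -> e j i = 0.
  by move=> jM li; rewrite /e li powR0 // gt_eqF // w_gt0.
have eX j i : (j < M.+2)%N -> e j i `^ pp j = l i `^ p.
  by move=> jM; rewrite /e -powRrM divfK // gt_eqF // pp_gt0.
(* Terms past the rank vanish, so factors of width d and of width n give the same sum. *)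
have e_sum j N : (j < M.+2)%N -> (\rank X <= N)%N ->
    \sum_(i < N) e j i `^ pp j = \sum_(i < n) l i `^ p.
  move=> jM rN; under eq_bigr => i _ do rewrite eX //.
  apply: (@sum_vanishing (fun i => l i `^ p) _ _ _ rN rn) => i ri.
  by rewrite l0 // powR0 // gt_eqF.
pose E := rect_id d n; pose E' := rect_id n d.
pose g i := e 0%N i / l i.
pose U1 : 'M[R]_(m, d) := X *m Q^T *m E' *m diagf d g.
pose mid j := diagf d (e j.+1).
pose UM : 'M[R]_(d, n) := diagf d (e M.+1) *m E *m Q.
exists U1, mid, UM; split.
  (* A column of X Q^T whose singular value is 0 has squared length 0, so projecting onto the
     nonzero singular values changes nothing. *)
  have XQl : X *m Q^T *m diagf n (fun i => (l i != 0)%:R) = X *m Q^T.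
    have : (X *m Q^T)^T *m (X *m Q^T) = diagf n (fun i => l i ^+ 2).
      rewrite trmx_mul trmxK mulmxA -(mulmxA Q) XE !mulmxA QQ mul1mx.
      by rewrite -mulmxA QQ mulmx1.
    move: (X *m Q^T) => Y YE; apply/matrixP => k i; rewrite mul_mx_diag !mxE.
    have [li|] := eqVneq (l i) 0; last by rewrite mulr1.
    move/matrixP: YE => /(_ i i); rewrite !mxE li expr0n mul0rn => /eqP.
    rewrite psumr_eq0 => [|k' _]; last by rewrite mxE -expr2 sqr_ge0.
    move=> /allP /(_ k (mem_index_enum k)) /=; rewrite mxE -expr2 sqrf_eq0 => /eqP ->.
    by rewrite mul0r.
  rewrite /factor_prod mprod_diagf !subSS subn0 /U1 /UM !mulmxA.
  rewrite -(mulmxA _ (diagf d g)) mul_diagf -(mulmxA _ (diagf d _) (diagf d _)) mul_diagf.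
  (* The exponents p / p_j sum to 1, so the e_j multiply to l, and the division in [g] leaves the
     indicator of l being nonzero. *)
  rewrite (@eq_diagf d _ (fun i => (l i != 0)%:R)) => [|i].
    rewrite -2!(mulmxA (X *m Q^T)) (@rect_id_diagf d n) => [|i /ld ->]; last by rewrite eqxx.
    by rewrite XQl -mulmxA QQ' mulmx1.
  have [li|li] := eqVneq (l i) 0; first by rewrite /g li invr0 mulr0 !mul0r.
  rewrite /g -!mulrA mulrCA.
  have -> : e 0%N i * (\prod_(j < M) e j.+1 i * e M.+1 i) = l i.
    transitivity (\prod_(j < M.+2) e j i).
      rewrite big_ord_recl big_ord_recr /=; congr (_ * (_ * _)).
    have l_gt0 : 0 < l i by rewrite lt_neqAle eq_sym li l_ge0.
    rewrite /e /powR (negPf li) -expR_sum -mulr_suml -mulr_sumr pp_sum.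
    by rewrite divff ?gt_eqF // mul1r lnK // posrE.
  by rewrite mulVf.
move=> j jM; rewrite /fnorm.
(* Each Gram matrix is diagonalized with entries e_j^2: in the standard basis for the first and the
   middle factors, in the rows of [Q] for the last. *)
case: ifPn => [/eqP j0|j_neq0].
  rewrite (@schatten_diagf m d U1 1%:M (e j)) ?pp_gt0 ?trmx1 ?mulmx1 // ?e_sum //.
  rewrite mul1mx j0 /U1 !trmx_mul tr_rect_id tr_diagf trmxK.
  rewrite !mulmxA -(mulmxA _ X^T) XE !mulmxA -(mulmxA _ Q Q^T) QQ mulmx1.
  rewrite -(mulmxA _ Q Q^T) QQ mulmx1.
  rewrite -/(diagf n (fun i => l i ^+ 2)) /E' -2!(mulmxA (diagf d g)).
  rewrite (@rect_id_diagf n d) => [|i /ln ->]; last by rewrite expr0n.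
  rewrite !mul_diagf; apply: eq_diagf => i; rewrite /g.
  have [li|li] := eqVneq (l i) 0; first by rewrite e0 // mul0r !mul0r expr0n.
  by field.
case: ifPn => [/eqP jM'|j_neqM].
  rewrite (@schatten_diagf d n UM Q (e j)) ?pp_gt0 // ?e_sum //.
  rewrite jM' /UM !trmx_mul tr_rect_id tr_diagf !mulmxA; congr (_ *m _).
  rewrite -!mulmxA (mulmxA (diagf _ _)) mul_diagf; congr (_ *m _); rewrite mulmxA.
  rewrite rect_id_diagf => [|i /ld li]; last by rewrite e0 // mul0r.
  exact: eq_diagf.
rewrite (@schatten_diagf d d _ 1%:M (e j)) ?pp_gt0 ?trmx1 ?mulmx1 // ?e_sum //.
by rewrite mul1mx /mid tr_diagf mul_diagf prednK ?lt0n.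
Qed.

End Attainment.

Theorem theorem5 (R : realType) (m n d M : nat) (X : 'M[R]_(m, n))
  (p : R) (pp : nat -> R) :
  (\rank X <= d)%N -> (2 <= M)%N ->
  0 < p -> p <= 1 ->
  (forall i, (i < M)%N -> 0 < pp i) ->
  \sum_(i < M) (pp i)^-1 = p^-1 ->
  (* first equality: min of the product of Schatten norms *)
  ((forall (U1 : 'M[R]_(m, d)) (mid : nat -> 'M[R]_d) (UM : 'M[R]_(d, n)), factor_prod M U1 mid UM = X ->
      schatten p X <= \prod_(i < M) fnorm M pp U1 mid UM i) /\
   (exists (U1 : 'M[R]_(m, d)) (mid : nat -> 'M[R]_d) (UM : 'M[R]_(d, n)), factor_prod M U1 mid UM = X /\
      schatten p X = \prod_(i < M) fnorm M pp U1 mid UM i)) /\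
  (* second equality: min of the weighted-sum expression *)
  ((forall (U1 : 'M[R]_(m, d)) (mid : nat -> 'M[R]_d) (UM : 'M[R]_(d, n)), factor_prod M U1 mid UM = X ->
      schatten p X <=
        ((\sum_(i < M) fnorm M pp U1 mid UM i `^ pp i / pp i) / p^-1) `^ p^-1) /\
   (exists (U1 : 'M[R]_(m, d)) (mid : nat -> 'M[R]_d) (UM : 'M[R]_(d, n)), factor_prod M U1 mid UM = X /\
      schatten p X =
        ((\sum_(i < M) fnorm M pp U1 mid UM i `^ pp i / pp i) / p^-1) `^ p^-1)).
Proof.
move=> rd M2 p_gt0 _ pp_gt0 pp_sum.
have pp_ord (j : 'I_M) : 0 < pp j by apply: pp_gt0.
have fn_ge0 U1 mid UM j : 0 <= fnorm M pp (U1 : 'M[R]_(m, d)) mid (UM : 'M[R]_(d, n)) j.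
  by rewrite /fnorm; do 2?case: ifP => _; apply: powR_ge0.
set S := \sum_(i < n) svals X i `^ p.
have S_ge0 : 0 <= S by apply: sumr_ge0 => i _; apply: powR_ge0.
have XS : schatten p X = S `^ p^-1 by rewrite schattenE.
have w_sum : \sum_(j < M) p / pp j = 1 by rewrite -mulr_sumr pp_sum divff ?gt_eqF.
have p_ge0 : 0 <= p^-1 by rewrite invr_ge0 ltW.
have lower U1 mid UM : factor_prod M U1 mid UM = X ->
    S <= \prod_(j < M) (fnorm M pp U1 mid UM j `^ pp j) `^ (p / pp j).
  by move=> VX; rewrite /S -VX; apply: sum_svals_factor_prod_le.
have [U1 [mid [UM [UX UN]]]] := balanced_factorization rd M2 p_gt0 pp_gt0 pp_sum.
have UN_ord (j : 'I_M) : fnorm M pp U1 mid UM j = S `^ (pp j)^-1 by apply: UN.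
split; split.
- move=> V1 V VM VX; rewrite XS.
  (* The exponents p_j, p / p_j and 1 / p multiply to 1. *)
  have -> : \prod_(j < M) fnorm M pp V1 V VM j =
      (\prod_(j < M) (fnorm M pp V1 V VM j `^ pp j) `^ (p / pp j)) `^ p^-1.
    rewrite powR_prod => [|j _]; last exact: powR_ge0.
    apply: eq_bigr => j _; rewrite -!powRrM [X in _ `^ X](_ : _ = 1) ?powRr1 //.
    by field; rewrite !gt_eqF.
  apply: ge0_ler_powR; rewrite ?nnegrE ?lower //.
  by apply: prodr_ge0 => j _; apply: powR_ge0.
- exists U1, mid, UM; split=> //; under eq_bigr => j _ do rewrite UN_ord.
  (* [powR] is an exponential of a logarithm only for a nonzero base; when S = 0 the factor of index
     0 already makes the product 0. *)
  have [S0|S_neq0] := eqVneq S 0.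
    rewrite XS S0 powR0 ?invr_neq0 ?gt_eqF //.
    rewrite (bigD1 (Ordinal (ltnW M2))) //= powR0 ?mul0r // invr_neq0 // gt_eqF //.
    by rewrite pp_gt0 // ltnW.
  by rewrite XS /powR (negPf S_neq0) -expR_sum -mulr_suml pp_sum.
- move=> V1 V VM VX; rewrite XS.
  apply: ge0_ler_powR; rewrite ?nnegrE //.
    rewrite divr_ge0 //; apply: sumr_ge0 => j _.
    by rewrite divr_ge0 ?powR_ge0 ?ltW.
  apply: le_trans (lower _ _ _ _ VX) _.
  (* AM-GM with the weights p / p_j, which are those of the mean on the right. *)
  apply: le_trans (prod_powR_le_weighted_sum
    (a := fun j : 'I_M => fnorm M pp V1 V VM j `^ pp j) _ _ w_sum) _.
  + by move=> j; rewrite divr_gt0.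
  + by move=> j; apply: powR_ge0.
  rewrite invrK mulr_suml; apply: ler_sum => j _.
  by rewrite mulrAC [p * _]mulrC mulrAC.
- exists U1, mid, UM; split=> //; rewrite XS; congr (_ `^ _).
  (* Every [fnorm j ^ pp j] equals S here, and so does their weighted mean. *)
  under eq_bigr => j _ do rewrite UN_ord -powRrM mulVf ?gt_eqF // powRr1 //.
  by rewrite -mulr_sumr pp_sum mulfK // invr_neq0 // gt_eqF.
Qed.
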